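(* Let $m,n\ge 1$ and $k,d\ge 0$ be integers, let $\pi\in L([n])$ with $\mathrm{pk}(\pi)=k$ and $\mathrm{des}(\pi)=d$, and let $\sigma\in L([n]+m)$. Then: (i) If $\mathrm{type}(\pi)=(t_1,\dots,t_{2k})$, $\chi^+(\pi)=0$ and $\pi\notin\Pi^{(1)}_{n,k,d}$, then there exists $\pi'\in\Pi^{(1)}_{n,k,d}$ with $(\mathrm{udr},\mathrm{pk},\mathrm{des})(\pi)=(\mathrm{udr},\mathrm{pk},\mathrm{des})(\pi')$ and $(\mathrm{udr},\mathrm{pk},\mathrm{des})S(\pi,\sigma)=(\mathrm{udr},\mathrm{pk},\mathrm{des})S(\pi',\sigma)$. (ii) If $\mathrm{type}(\pi)=(t_1,\dots,t_{2k+1})$, $\chi^+(\pi)=0$ and $\pi\notin\Pi^{(2)}_{n,k,d}$, then the same conclusion holds with some $\pi'\in\Pi^{(2)}_{n,k,d}$. (iii) If $\mathrm{type}(\pi)=(t_1,\dots,t_{2k+1})$, $\chi^+(\pi)=1$ and $\pi\notin\Pi^{(3)}_{n,k,d}$, then the same conclusion holds with some $\pi'\in\Pi^{(3)}_{n,k,d}$. (iv) If $\mathrm{type}(\pi)=(t_1,\dots,t_{2k+2})$, $\chi^+(\pi)=1$ and $\pi\notin\Pi^{(4)}_{n,k,d}$, then the same conclusion holds with some $\pi'\in\Pi^{(4)}_{n,k,d}$.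
   Context: $[n]=\{1,\dots,n\}$, $[n]+m=\{n+1,\dots,n+m\}$. For a finite $U\subset\mathbb{P}$, $L(U)$ is the set of permutations (words) of $U$. For $\pi=\pi_1\cdots\pi_n$: $\mathrm{des}(\pi)$ is the number of $i\in[n-1]$ with $\pi_i>\pi_{i+1}$; $\mathrm{pk}(\pi)$ is the number of $i$ with $2\le i\le n-1$ and $\pi_{i-1}<\pi_i>\pi_{i+1}$. A birun of a word is a maximal factor of consecutive entries that is strictly increasing or strictly decreasing (consecutive biruns share their common endpoint; e.g. $6534792$ has biruns $653,3479,92$). $\mathrm{udr}(\pi)$ is the number of biruns of the word $0\pi_1\cdots\pi_n$. $\mathrm{type}(\pi)=(t_1,\dots,t_r)$ lists the lengths of the biruns of $\pi$ from left to right. $\chi^+(\pi)=1$ if $\pi_1>\pi_2$, else $0$. For disjoint $U,V$, $\pi\in L(U)$, $\sigma\in L(V)$, $S(\pi,\sigma)$ is the set of $\tau\in L(U\cup V)$ containing both $\pi$ and $\sigma$ as subsequences, and $(\mathrm{udr},\mathrm{pk},\mathrm{des})S(\pi,\sigma)$ denotes the multiset $\{(\mathrm{udr}(\tau),\mathrm{pk}(\tau),\mathrm{des}(\tau)):\tau\in S(\pi,\sigma)\}$. Define: $\Pi^{(1)}_{n,k,d}=\{\pi\in L([n]):\chi^+(\pi)=0,\ \mathrm{type}(\pi)=(t_1,\dots,t_{2k})\}$ with $t_1=n-d-k+1$, $t_2=d-k+2$, $t_i=2$ for $2<i\le 2k$; $\Pi^{(2)}_{n,k,d}=\{\pi\in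 L([n]):\chi^+(\pi)=0,\ \mathrm{type}(\pi)=(t_1,\dots,t_{2k+1})\}$ with $t_1=n-d-k$, $t_2=d-k+2$, $t_i=2$ for $2<i\le 2k+1$; $\Pi^{(3)}_{n,k,d}=\{\pi\in L([n]):\chi^+(\pi)=1,\ \mathrm{type}(\pi)=(t_1,\dots,t_{2k+1})\}$ with $t_1=d-k+1$, $t_2=n-d-k+1$, $t_i=2$ for $2<i\le 2k+1$; $\Pi^{(4)}_{n,k,d}=\{\pi\in L([n]):\chi^+(\pi)=1,\ \mathrm{type}(\pi)=(t_1,\dots,t_{2k+2})\}$ with $t_1=d-k+1$, $t_2=n-d-k$, $t_i=2$ for $2<i\le 2k+2$. *)

(* Defs.v *)
From mathcomp Require Import all_boot.

Set Implicit Arguments.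
Unset Strict Implicit.
Unset Printing Implicit Defensive.

(* A finite set U of positive integers is given by a duplicate-free sequence:
   [n] is iota 1 n, and [n]+m = {n+1, ..., n+m} is iota n.+1 m. *)
Definition L (U : seq nat) : pred (seq nat) := [pred w | perm_eq w U].

(* Positions are 0-based, so the i-th letter is nth 0 w i.-1. *)
Definition des (w : seq nat) : nat :=
  count (fun i => nth 0 w i > nth 0 w i.+1) (iota 0 (size w).-1).

Definition pk (w : seq nat) : nat :=
  count (fun i => (nth 0 w i.-1 < nth 0 w i) && (nth 0 w i > nth 0 w i.+1))
        (iota 1 (size w - 2)).

Definition monotone (w : seq nat) : bool := sorted ltn w || sorted gtn w.

(* The pair p = (i, j) stands for the factor at positions i, ..., j - 1. *)
Definition factor (w : seq nat) (p : nat * nat) : seq nat :=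
  take (p.2 - p.1) (drop p.1 w).

(* All pairs (i, j) with i < j <= size w, ordered by increasing i. *)
Definition positions (w : seq nat) : seq (nat * nat) :=
  [seq (i, j) | i <- iota 0 (size w), j <- iota i.+1 (size w - i)].

Definition is_birun (w : seq nat) (p : nat * nat) : bool :=
  monotone (factor w p) &&
  all (fun q => [&& q.1 <= p.1, p.2 <= q.2 & monotone (factor w q)] ==> (q == p))
      (positions w).

(* A one-letter word has exactly one birun, of length 1. *)
Definition biruns (w : seq nat) : seq (seq nat) :=
  [seq factor w p | p <- positions w & is_birun w p].

Definition udr (w : seq nat) : nat := size (biruns (0 :: w)).

Definition type (w : seq nat) : seq nat := [seq size b | b <- biruns w].

Definition chi_plus (w : seq nat) : nat :=
  if w is x :: y :: _ then x > y else 0.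

Definition shuffles (pi sigma : seq nat) : seq (seq nat) :=
  [seq tau <- permutations (pi ++ sigma) | subseq pi tau & subseq sigma tau].

Definition stat (w : seq nat) : nat * nat * nat := (udr w, pk w, des w).

(* The multiset of values on shuffles pi sigma, up to perm_eq. *)
Definition statS (pi sigma : seq nat) : seq (nat * nat * nat) :=
  [seq stat tau | tau <- shuffles pi sigma].

(* (t1, t2, 2, ..., 2) truncated to its first r terms. *)
Definition hook_type (r t1 t2 : nat) : seq nat := mkseq (nth 2 [:: t1; t2]) r.

(* Subtraction is truncated, but only when the integer value is negative; as
   birun lengths are positive, such a value is never a birun length, whether or
   not it is truncated to 0. *)
Definition Pi1 (n k d : nat) : pred (seq nat) :=
  [pred w | [&& w \in L (iota 1 n), chi_plus w == 0 &
     type w == hook_type (2 * k) (n + 1 - (d + k)) (d + 2 - k)]].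

Definition Pi2 (n k d : nat) : pred (seq nat) :=
  [pred w | [&& w \in L (iota 1 n), chi_plus w == 0 &
     type w == hook_type (2 * k + 1) (n - (d + k)) (d + 2 - k)]].

Definition Pi3 (n k d : nat) : pred (seq nat) :=
  [pred w | [&& w \in L (iota 1 n), chi_plus w == 1 &
     type w == hook_type (2 * k + 1) (d + 1 - k) (n + 1 - (d + k))]].

Definition Pi4 (n k d : nat) : pred (seq nat) :=
  [pred w | [&& w \in L (iota 1 n), chi_plus w == 1 &
     type w == hook_type (2 * k + 2) (d + 1 - k) (n - (d + k))]].

(* Main.v *)
Require Import Defs.
From mathcomp Require Import all_boot zify.

Set Implicit Arguments.
Unset Strict Implicit.
Unset Printing Implicit Defensive.

(** A word w of positive letters is studied through the up/down pattern s of 0w,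
a word over {U, D} starting with U. The biruns of 0w correspond to the maximal
constant runs of s, des counts the letters D, and (udr, pk) is equivalent to the
number of factors UD of s together with its second and its last letter.

All letters of sigma exceed those of pi, so a shuffle is obtained by inserting
consecutive factors of sigma into the gaps of pi, and inserting a nonempty
factor f replaces the letter of s at that gap by U p(f) D, with p(f) the pattern
of f (in the gap after pi it appends U p(f)). A factor UD of s survives exactly
when neither of its letters is replaced. Hence, classifying the letters of s by
their value and by whether they belong to a factor UD, the statistics of a
shuffle depend only on the inserted factors, in order, and on the list, for each
class, of which of its letters are replaced. Two patterns with the same length
and statistics have classes of the same sizes, so these data can be carried over
from one to the other, which gives a bijection between the shuffles. It remains
to note that the run lengths of a pattern can be changed into a hook without
changing the statistics, and that every pattern is realized by a permutation. *)

(** * Biruns and up/down patterns *)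

Definition no_flat (w : seq nat) : bool := sorted [rel x y | x != y] w.

Lemma uniq_no_flat w : uniq w -> no_flat w.
Proof. rewrite uniq_pairwise; exact: pairwise_sorted. Qed.

(* The letter [true] stands for a descent. *)
Definition pattern (w : seq nat) : bitseq :=
  if w is x :: w' then pairmap gtn x w' else [::].

Lemma size_pattern w : size (pattern w) = (size w).-1.
Proof. by case: w => [|x w] //=; rewrite size_pairmap. Qed.

Lemma pattern_take j w : pattern (take j w) = take j.-1 (pattern w).
Proof.
case: w j => [|x w] [|j] //=; first by rewrite take0.
by elim: w x j => [|y w IHw] x [|j] //=; rewrite IHw.
Qed.

Lemma chi_plus_pattern w : chi_plus w = head false (pattern w).
Proof. by case: w => [|x [|y w]]. Qed.

Lemma des_pattern w : des w = count id (pattern w).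
Proof.
rewrite /des; case: w => [|x w] //=.
elim: w x => [|y w IHw] x //=; congr (_ + _).
by rewrite -IHw (iotaDl 1 0) count_map; apply: eq_count.
Qed.

Lemma monotone_pattern w : no_flat w -> monotone w = constant (pattern w).
Proof.
case: w => [|x [|y w]] //= no_flat_w.
have descending : sorted gtn [:: x, y & w] = all id (pattern [:: x, y & w]).
  by rewrite /=; elim: w x y {no_flat_w} => [|z w IHw] x y //=; rewrite IHw.
have ascending : sorted ltn [:: x, y & w] = all negb (pattern [:: x, y & w]).
  elim: w x y no_flat_w {descending} => [|z w IHw] x y /=.
    by case: ltngtP.
  by case/andP=> neq_xy /IHw /= ->; case: ltngtP neq_xy.
rewrite /monotone descending ascending /=.
case: (y < x) => /=; last rewrite orbF.
  by apply: eq_all => -[].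
by apply: eq_all => -[].
Qed.

Fixpoint runs (s : bitseq) : seq nat :=
  if s is b :: s' then
    if b == head (~~ b) s' then incr_nth (runs s') 0 else 1 :: runs s'
  else [::].

Lemma runs_cons b c s :
  runs (b :: c :: s) =
  if b == c then (head 0 (runs (c :: s))).+1 :: behead (runs (c :: s))
  else 1 :: runs (c :: s).
Proof.
rewrite [LHS]/= -/(runs (c :: s)); case: eqP => // _.
by case: (runs (c :: s)).
Qed.

Lemma head_runs_gt0 b s : 0 < head 0 (runs (b :: s)).
Proof. by case: s => [|c s]; [case: b | rewrite runs_cons; case: ifP]. Qed.

Lemma runs_gt0 s : all (leq 1) (runs s).
Proof.
elim: s => [|b [|c s] IHs] //; first by case: b.
rewrite runs_cons; case: ifP => _; last by rewrite /= IHs.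
by case: (runs _) IHs => [|r rs] //= /andP[].
Qed.

Lemma head_runs_leq s : head 0 (runs s) <= size s.
Proof.
elim: s => [|b [|c s] IHs] //; first by case: b.
by rewrite runs_cons; case: ifP.
Qed.

Lemma constant_take j s :
  j <= size s -> constant (take j s) = (j <= head 0 (runs s)).
Proof.
elim: s j => [|b [|c s] IHs] [|[|j]] // le_j; first by case: b {IHs le_j}.
  by rewrite take_cons take0 head_runs_gt0.
rewrite runs_cons [LHS]/= [c == b]eq_sym; case: eqP => //= ->.
exact: (IHs j.+1).
Qed.

Definition first_birun_size (w : seq nat) : nat :=
  (head 0 (runs (pattern w))).+1.

Lemma first_birun_size_leq w : 0 < size w -> first_birun_size w <= size w.
Proof.
by move=> w_gt0; rewrite -(prednK w_gt0) ltnS -size_pattern head_runs_leq.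
Qed.

Lemma monotone_take w j :
  no_flat w -> j <= size w -> monotone (take j w) = (j <= first_birun_size w).
Proof.
move=> no_flat_w le_j; rewrite monotone_pattern; last exact: take_sorted.
rewrite pattern_take constant_take; last by rewrite size_pattern; lia.
by rewrite /first_birun_size; case: j {le_j}.
Qed.

Lemma mem_positions w i j : ((i, j) \in positions w) = (i < j <= size w).
Proof.
apply/allpairsPdep/idP => [[k [l]]|lt_ij].
  by rewrite !mem_iota => -[k_lt l_lt [-> ->]]; lia.
by exists i, j; rewrite !mem_iota; split=> //; lia.
Qed.

Definition shift_ends (p : nat * nat) : nat * nat := (p.1.+1, p.2.+1).

Lemma positions_cons x w :
  positions (x :: w) =
  [seq (0, j) | j <- iota 1 (size w).+1] ++ map shift_ends (positions w).
Proof.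
rewrite /positions /=; congr (_ :: _ ++ _).
rewrite map_flatten -map_comp (iotaDl 1 0) -map_comp; congr flatten.
apply: eq_map => i /=; rewrite add1n subSS -map_comp (iotaDl 1 i.+1) -map_comp.
by apply: eq_map => j /=; rewrite add1n.
Qed.

Lemma is_birunP w p : reflect
  (monotone (factor w p) /\
   forall i j, i < j <= size w -> i <= p.1 -> p.2 <= j ->
     monotone (factor w (i, j)) -> (i, j) = p)
  (is_birun w p).
Proof.
apply: (iffP andP) => -[mono_p max_p]; split=> //.
  move=> i j ij le_i le_j mono_ij.
  have /(allP max_p) /= : (i, j) \in positions w by rewrite mem_positions.
  by rewrite le_i le_j mono_ij /= => /eqP.
apply/allP => -[i j]; rewrite mem_positions => ij.
by apply/implyP => /and3P[] /= le_i le_j mono_ij; apply/eqP/max_p.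
Qed.

Lemma factor0 w j : factor w (0, j) = take j w.
Proof. by rewrite /factor /= subn0 drop0. Qed.

Lemma factor_shift x w p : factor (x :: w) (shift_ends p) = factor w p.
Proof. by rewrite /factor /= subSS. Qed.

Lemma is_birun0 w j :
  no_flat w -> 0 < j <= size w -> is_birun w (0, j) = (j == first_birun_size w).
Proof.
move=> no_flat_w /andP[j_gt0 le_j].
have le_first : first_birun_size w <= size w.
  by apply: first_birun_size_leq; apply: leq_trans le_j.
apply/is_birunP/eqP => [[]|->].
  rewrite factor0 monotone_take // => le_j_first max_j.
  have := max_j 0 (first_birun_size w).
  rewrite factor0 monotone_take // leqnn /= le_first.
  by move=> /(_ isT isT le_j_first isT) [].
rewrite factor0 monotone_take //; split=> // i l /= il.
rewrite leqn0 => /eqP i0; rewrite {i}i0 in il * => le_first_l.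
rewrite factor0 monotone_take //; last by case/andP: il.
by move=> le_l; congr (_, _); apply/eqP; rewrite eqn_leq le_l.
Qed.

Lemma filter_birun0 w : no_flat w -> 0 < size w ->
  [seq p <- [seq (0, j) | j <- iota 1 (size w)] | is_birun w p] =
  [:: (0, first_birun_size w)].
Proof.
move=> no_flat_w w_gt0; rewrite filter_map.
rewrite (@eq_in_filter _ _ (pred1 (first_birun_size w))); last first.
  by move=> j; rewrite mem_iota => jw /=; rewrite is_birun0 // -ltnS.
rewrite filter_pred1_uniq ?iota_uniq // mem_iota /= add1n ltnS.
exact: first_birun_size_leq.
Qed.

Lemma is_birun_shift x w p : p.1 < p.2 <= size w ->
  is_birun (x :: w) (shift_ends p) =
  is_birun w p && ~~ monotone (take p.2.+1 (x :: w)).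
Proof.
case: p => i j /= ij.
apply/is_birunP/andP => [[]|[/is_birunP[] mono_ij max_ij not_mono]].
  rewrite factor_shift => mono_ij max_ij; split; last first.
    have j_le : 0 < j.+1 <= size (x :: w) by case/andP: ij.
    apply/negP => mono_j.
    by have := max_ij 0 j.+1 j_le isT (leqnn _); rewrite factor0 => /(_ mono_j).
  apply/is_birunP; split=> // i' j' ij' le_i le_j mono_ij'.
  have := max_ij i'.+1 j'.+1 ij' le_i le_j.
  by rewrite (factor_shift x w (i', j')) => /(_ mono_ij') [-> ->].
rewrite factor_shift; split=> // -[|i'] [|j'] //= ij' le_i le_j.
  rewrite factor0 => mono_j'; case/negP: not_mono.
  rewrite -[x :: _]/(take j.+1 (x :: w)) -(take_takel (x :: w) le_j).
  case/orP: mono_j' => /(take_sorted j.+1) mono_take;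
    by rewrite /monotone mono_take ?orbT.
rewrite (factor_shift x w (i', j')) => mono_ij'.
by have <- := max_ij i' j' ij' le_i le_j mono_ij'.
Qed.

(* Consecutive biruns share a letter, so a run of [r] pattern letters gives a
   birun of [r.+1] letters. *)
Fixpoint run_bounds (i : nat) (rs : seq nat) : seq (nat * nat) :=
  if rs is r :: rs' then (i, (i + r).+1) :: run_bounds (i + r) rs' else [::].

Lemma run_boundsS i rs : run_bounds i.+1 rs = map shift_ends (run_bounds i rs).
Proof. by elim: rs i => [|r rs IHrs] i //=; rewrite -IHrs. Qed.

Lemma run_bounds_gt i rs :
  all (leq 1) rs -> all (fun p => i.+1 < p.2) (run_bounds i rs).
Proof.
elim: rs i => [|r rs IHrs] i //= /andP[r_gt0 /(IHrs (i + r)) gt_ir].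
apply/andP; split; first by lia.
apply: sub_all gt_ir => p.
by apply: leq_ltn_trans; rewrite ltnS leq_addr.
Qed.

Lemma filter_birun_cons x w : no_flat (x :: w) ->
  [seq p <- positions (x :: w) | is_birun (x :: w) p] =
  (0, first_birun_size (x :: w)) ::
  map shift_ends
    [seq p <- positions w | is_birun w p & first_birun_size (x :: w) <= p.2].
Proof.
move=> no_flat_xw.
rewrite positions_cons filter_cat filter_birun0 // filter_map.
congr (_ :: map _ _); apply: eq_in_filter => -[i j].
rewrite mem_positions => ij /=.
by rewrite is_birun_shift // monotone_take -?leqNgt //; case/andP: ij.
Qed.

Lemma filter_birun w : no_flat w -> 1 < size w ->
  [seq p <- positions w | is_birun w p] = run_bounds 0 (runs (pattern w)).
Proof.
elim: w => [|x [|y [|z w]] IHw] // no_flat_w _.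
  rewrite filter_birun_cons // (_ : positions [:: y] = [:: (0, 1)]) //.
  by rewrite /first_birun_size /=; case: (y < x).
rewrite filter_birun_cons // (eq_filter (fun p => andbC _ _)) filter_predI.
rewrite (IHw (path_sorted no_flat_w) isT).
have := runs_gt0 (pattern [:: y, z & w]).
have := runs_cons (y < x) (z < y) (pattern (z :: w)).
rewrite /first_birun_size [pattern (x :: _)]/= [pattern (y :: _)]/=.
rewrite -/(pattern (z :: w)) => ->.
case: (runs _) (head_runs_gt0 (z < y) (pattern (z :: w))) => [|r rs] //= r_gt0.
move=> /andP[_ /(run_bounds_gt r) bounds_gt].
case: ifP => _ /=; rewrite !add0n ?ltnn ?r_gt0 run_boundsS.
  by congr (_ :: map _ _); apply/all_filterP.
rewrite /= (all_filterP _) ?ltnS ?r_gt0 //.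
by apply: sub_all bounds_gt => p; apply: leq_trans.
Qed.

Lemma type_pattern w :
  no_flat w -> 1 < size w -> type w = map S (runs (pattern w)).
Proof.
move=> no_flat_w w_gt1; rewrite /type /biruns -map_comp.
transitivity [seq p.2 - p.1 | p <- positions w & is_birun w p].
  apply/eq_in_map => -[i j]; rewrite mem_filter mem_positions => /andP[_ ij] /=.
  by rewrite size_takel // size_drop /=; lia.
rewrite filter_birun //; elim: (runs _) (0) => //= r rs IHrs i.
by rewrite IHrs subSn ?leq_addr // addKn.
Qed.

(** * Rearranging a sequence along its keys *)

Section Redistribute.

Variable K : eqType.
Implicit Types (k : K) (ks : seq K).

Definition fiber (T : Type) (ks : seq K) (l : seq T) (k : K) : seq T :=
  mask (map (pred1 k) ks) l.

Fixpoint assemble (T : Type) (ks : seq K) (F : K -> seq T) : seq T :=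
  if ks is k :: ks' then
    take 1 (F k) ++ assemble ks' [eta F with k |-> behead (F k)]
  else [::].

(* The [i]-th item with key [k] becomes again the [i]-th item with key [k]. *)
Definition redistribute (T : Type) (ks ks' : seq K) (l : seq T) : seq T :=
  assemble ks' (fiber ks l).

Definition fills (T : Type) (ks : seq K) (F : K -> seq T) : Prop :=
  forall k, size (F k) = count_mem k ks.

Lemma fills_fiber T ks (l : seq T) : size l = size ks -> fills ks (fiber ks l).
Proof.
by move=> sz_l k; rewrite size_mask ?size_map // count_map; apply: eq_count.
Qed.

Lemma fills_behead T k ks (F : K -> seq T) :
  fills (k :: ks) F -> fills ks [eta F with k |-> behead (F k)].
Proof.
move=> fillsF j /=; have := fillsF j; rewrite /= [k == j]eq_sym.
by case: eqP => [->|] // sz_Fk; rewrite size_behead sz_Fk.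
Qed.

Lemma fiber_keys ks k : fiber ks ks k = nseq (count_mem k ks) k.
Proof.
rewrite /fiber -filter_mask -size_filter.
by apply/all_pred1P/allP => x; rewrite mem_filter => /andP[].
Qed.

Lemma map_fiber T T' (f : T -> T') ks l k :
  map f (fiber ks l k) = fiber ks (map f l) k.
Proof. exact: map_mask. Qed.

Lemma last_fiber T (x : T) k0 ks l : ks != [::] -> size l = size ks ->
  last x (fiber ks l (last k0 ks)) = last x l.
Proof.
case/lastP: ks => // ks k _.
case/lastP: l => [|l y]; rewrite !size_rcons // => -[sz_l].
rewrite !last_rcons /fiber map_rcons mask_rcons ?size_map //= eqxx.
by rewrite cats1 last_rcons.
Qed.

Lemma eq_assemble T ks (F G : K -> seq T) :
  F =1 G -> assemble ks F = assemble ks G.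
Proof.
elim: ks F G => [|k ks IHks] F G eqFG //=; rewrite eqFG; congr (_ ++ _).
by apply: IHks => j /=; rewrite eqFG.
Qed.

Lemma map_assemble T T' (f : T -> T') ks F :
  map f (assemble ks F) = assemble ks (map f \o F).
Proof.
elim: ks F => [|k ks IHks] F //=; rewrite map_cat map_take IHks; congr (_ ++ _).
by apply: eq_assemble => j /=; case: eqP => // _; case: (F k).
Qed.

Lemma fiberK T ks (l : seq T) :
  size l = size ks -> assemble ks (fiber ks l) = l.
Proof.
elim: ks l => [|k ks IHks] [|x l] //= [sz_l].
rewrite {1}/fiber /= eqxx /= take0; congr (_ :: _); rewrite -[RHS](IHks l sz_l).
apply: eq_assemble => j; rewrite /= /fiber /= eqxx [k == j]eq_sym.
by case: eqP => [->|].
Qed.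

Lemma size_assemble T ks (F : K -> seq T) :
  fills ks F -> size (assemble ks F) = size ks.
Proof.
elim: ks F => [|k ks IHks] F fillsF //=.
rewrite size_cat (IHks _ (fills_behead fillsF)) size_take (fillsF k) /= eqxx.
by case: (count_mem k ks).
Qed.

Lemma assembleK T ks (F : K -> seq T) :
  fills ks F -> fiber ks (assemble ks F) =1 F.
Proof.
elim: ks F => [|k ks IHks] F fillsF j; first by case: (F j) (fillsF j).
have := fills_behead fillsF; have /= := fillsF k; rewrite eqxx.
case Fk: (F k) => [|x l] //= _ fills_tail.
rewrite /fiber /= take0 /= -/(fiber _ _ _) IHks //=.
by rewrite [k == j]eq_sym; case: eqP => [->|].
Qed.

Lemma count_zip_fiber (T : eqType) ks (l : seq T) k x :
  count_mem (k, x) (zip ks l) = count_mem x (fiber ks l k).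
Proof.
elim: ks l => [|j ks IHks] [|y l] //=.
by rewrite /fiber /= IHks xpair_eqE; case: eqP.
Qed.

Section PermKeys.

Variables (T : eqType) (ks ks' : seq K) (l : seq T).
Hypotheses (perm_ks : perm_eq ks ks') (size_l : size l = size ks).

Let fills_fiber_perm : fills ks' (fiber ks l).
Proof. by move=> k; rewrite fills_fiber // (permP perm_ks). Qed.

Lemma size_redistribute : size (redistribute ks ks' l) = size ks'.
Proof. exact: size_assemble fills_fiber_perm. Qed.

Lemma fiber_redistribute : fiber ks' (redistribute ks ks' l) =1 fiber ks l.
Proof. exact: assembleK fills_fiber_perm. Qed.

Lemma redistributeK : redistribute ks' ks (redistribute ks ks' l) = l.
Proof. by rewrite [LHS](eq_assemble _ fiber_redistribute) fiberK. Qed.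

Lemma perm_zip_redistribute :
  perm_eq (zip ks' (redistribute ks ks' l)) (zip ks l).
Proof.
by apply/allP => -[k x] _ /=; rewrite !count_zip_fiber fiber_redistribute.
Qed.

Lemma perm_redistribute : perm_eq (redistribute ks ks' l) l.
Proof.
have := perm_map snd perm_zip_redistribute.
by rewrite -/(unzip2 _) -/(unzip2 _) !unzip2_zip ?size_redistribute ?size_l.
Qed.

End PermKeys.

Lemma map_redistribute T T' (f : T -> T') ks ks' l :
  map f (redistribute ks ks' l) = redistribute ks ks' (map f l).
Proof. by rewrite map_assemble; apply: eq_assemble => k; apply: map_fiber. Qed.

Lemma redistribute_keys ks ks' : perm_eq ks ks' -> redistribute ks ks' ks = ks'.
Proof.
move=> perm_ks; rewrite -[RHS](fiberK (erefl (size ks'))).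
by apply: eq_assemble => k; rewrite !fiber_keys (permP perm_ks).
Qed.

End Redistribute.

(** * The profile of a pattern *)

Lemma count_mem_true (s : bitseq) : count_mem true s = count id s.
Proof. by apply: eq_count => -[]. Qed.

Lemma count_mem_false (s : bitseq) : count_mem false s = size s - count id s.
Proof.
by rewrite -(count_predC id s) addKn; apply: eq_count => -[].
Qed.

Lemma perm_bitseq (s s' : bitseq) :
  size s = size s' -> count id s = count id s' -> perm_eq s s'.
Proof.
move=> eq_size eq_des; apply/allP => -[] _ /=.
  by rewrite !count_mem_true eq_des.
by rewrite !count_mem_false eq_size eq_des.
Qed.

(* The peaks are the factors UD, and [p] is the letter before [s]. *)
Definition peaks (p : bool) (s : bitseq) : nat :=
  count id (pairmap (fun b c => ~~ b && c) p s).

Lemma peaks_cat p s1 s2 :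
  peaks p (s1 ++ s2) = peaks p s1 + peaks (last p s1) s2.
Proof. by rewrite /peaks pairmap_cat count_cat. Qed.

Lemma pk_pattern w : no_flat w -> pk w = peaks true (pattern w).
Proof.
rewrite /pk; elim: w => [|x [|y [|z w]] IHw] // no_flat_w.
have neq_xy : x != y by case/andP: no_flat_w.
have -> : iota 1 (size [:: x, y, z & w] - 2) =
    1 :: map S (iota 1 (size [:: y, z & w] - 2)).
  by rewrite /= !subSS !subn0 /= -(eq_map add1n) -iotaDl.
rewrite [LHS]/= count_map.
have -> : peaks true (pattern [:: x, y, z & w]) =
    (~~ (y < x) && (z < y)) + peaks true (pattern [:: y, z & w]) by [].
rewrite -IHw; last exact: path_sorted no_flat_w.
congr (_ + _); first by case: ltngtP neq_xy.
by apply: eq_in_count => -[|i] //; rewrite mem_iota.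
Qed.

Lemma size_runs b s : size (runs (b :: s)) = (peaks b s).*2 + b + ~~ last b s.
Proof.
elim: s b => [|c s IHs] b; first by case: b.
rewrite runs_cons -[peaks b (c :: s)]/((~~ b && c) + peaks c s); have := IHs c.
case: eqP => [<-|neq_bc] size_cs.
  rewrite andNb -[RHS]size_cs.
  by case: (runs _) (head_runs_gt0 b s).
rewrite [size _]/= size_cs.
by case: b c neq_bc {size_cs} => [] [] // _ /=; lia.
Qed.

Lemma udr_pattern w : no_flat (0 :: w) -> 0 < size w ->
  udr w = size (runs (pattern (0 :: w))).
Proof.
move=> no_flat_w w_gt0; rewrite /udr -(size_map size) -/(type (0 :: w)).
by rewrite type_pattern ?size_map.
Qed.

Definition profile (s : bitseq) : nat * nat * bool * bool :=
  (peaks true s, count id s, nth false s 1, last false s).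

Lemma stat_profile w : no_flat (0 :: w) -> 0 < size w ->
  let: (u, d, snd, lst) := profile (pattern (0 :: w)) in
  stat w = (u.*2 + ~~ lst, u - snd, d).
Proof.
move=> no_flat_w w_gt0; rewrite /= /stat udr_pattern // des_pattern.
rewrite pk_pattern; last exact: path_sorted no_flat_w.
case: w w_gt0 {no_flat_w} => [|x w] // _.
rewrite [pattern (0 :: _)]/= size_runs /= addn0 add0n; congr (_, _, _).
by case: w => [|y w] //; rewrite /peaks /= !add0n addKn.
Qed.

Lemma stat_eq_profile w w' :
    no_flat (0 :: w) -> no_flat (0 :: w') -> 0 < size w -> 0 < size w' ->
  (stat w == stat w') =
  (profile (pattern (0 :: w)) == profile (pattern (0 :: w'))).
Proof.
move=> no_flat_w no_flat_w' w_gt0 w'_gt0.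
have peaks_ge v :
    nth false (pattern (0 :: v)) 1 <= peaks true (pattern (0 :: v)).
  by case: v => [|x [|y v]] //=; rewrite /peaks /=; case: (y < x).
have := (peaks_ge w, peaks_ge w'); have := stat_profile no_flat_w w_gt0.
have := stat_profile no_flat_w' w'_gt0; rewrite /profile => -> -> [].
rewrite !xpair_eqE.
by do 2![case: (nth false _ 1); case: (last false _)] => /=; lia.
Qed.

Lemma stat_type w : no_flat (0 :: w) -> 1 < size w ->
  stat w = (size (type w) + chi_plus w, (size (type w) - chi_plus w)./2, des w).
Proof.
move=> no_flat_0w w_gt1; have no_flat_w : no_flat w := path_sorted no_flat_0w.
rewrite /stat udr_pattern ?(ltnW w_gt1) // pk_pattern //.
rewrite type_pattern // size_map.
case: w w_gt1 {no_flat_0w no_flat_w} => [|x [|y w]] // _.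
rewrite [pattern (0 :: _)]/= [pattern (x :: _)]/= !size_runs /peaks /=.
by congr (_, _, _); lia.
Qed.

(** * Inserting factors into a pattern *)

Definition nonempty (f : seq nat) : bool := f != [::].

(* Inserting a nonempty [f] with larger letters replaces [b] by U p(f) D. *)
Definition splice (b : bool) (f : seq nat) : bitseq :=
  rcons (pattern (0 :: f)) (b || nonempty f).

Fixpoint splices (s : bitseq) (fs : seq (seq nat)) : bitseq :=
  if (s, fs) is (b :: s', f :: fs') then splice b f ++ splices s' fs' else [::].

Lemma size_splices s fs :
  size fs = size s -> size (splices s fs) = size s + size (flatten fs).
Proof.
elim: s fs => [|b s IHs] [|f fs] //= [/IHs sz].
by rewrite !size_cat sz size_rcons size_pairmap; lia.
Qed.

(* The letter [b] has kind [(b, c)], where [c] tells whether it belongs to a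
   factor UD; [p] is the preceding letter. *)
Fixpoint kinds (p : bool) (s : bitseq) : seq (bool * bool) :=
  if s is b :: s' then
    (b, if b then ~~ p else head false s') :: kinds b s'
  else [::].

Lemma size_kinds p s : size (kinds p s) = size s.
Proof. by elim: s p => //= b s IHs p; rewrite IHs. Qed.

Lemma last_kinds p s : last true s = false ->
  last (false, false) (kinds p s) = (false, false).
Proof.
elim: s p => [|b [|c s] IHs] p //; first by case: b {IHs}.
exact: (IHs b).
Qed.

Lemma count_kinds_from p s : [/\ count_mem (true, true) (kinds p s) = peaks p s,
  count_mem (false, true) (kinds p s) + (~~ p && head false s) = peaks p s &
  forall b, count_mem (b, true) (kinds p s) + count_mem (b, false) (kinds p s) =
    count_mem b s].
Proof.
elim: s p => [|b s IHs] p; first by rewrite andbF.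
have [D_UD U_UD total] := IHs b.
split=> [| |c]; rewrite /peaks /= -/(peaks b s).
- by rewrite D_UD; case: b p {IHs D_UD U_UD total} => [] [].
- rewrite -U_UD; case: b p {IHs D_UD U_UD total} => [] [] //=;
    case: (head false s) => /=; lia.
- rewrite -total; case: b c {IHs D_UD U_UD total} => [] [] //=;
    [case: p | case: (head false s)] => /=; lia.
Qed.

Lemma count_kinds s b c : count_mem (b, c) (kinds true s) =
  if c then peaks true s else count_mem b s - peaks true s.
Proof.
have [D_UD U_UD total] := count_kinds_from true s; rewrite addn0 in U_UD.
have kinds_UD : count_mem (b, true) (kinds true s) = peaks true s by case: b.
by case: c => //; rewrite -total kinds_UD addKn.
Qed.

Lemma perm_kinds s s' : perm_eq s s' -> peaks true s = peaks true s' ->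
  perm_eq (kinds true s) (kinds true s').
Proof.
move=> /permP perm_s eq_peaks; apply/allP => -[b c] _ /=.
by rewrite !count_kinds eq_peaks perm_s.
Qed.

Definition marks (s : bitseq) (fs : seq (seq nat)) : bool * bool -> bitseq :=
  fiber (kinds true s) (map nonempty fs).

Lemma count_splices p s fs : size fs = size s ->
  count id (splices s fs) =
  sumn [seq count id (pattern (0 :: f)) | f <- fs] +
    count (fun x => x.1.1 || x.2) (zip (kinds p s) (map nonempty fs)).
Proof.
elim: s p fs => [|b s IHs] p [|f fs] //= [/(IHs b) count_s].
by rewrite count_cat count_s /splice -cats1 count_cat /=; lia.
Qed.

Lemma peaks_splice p b f :
  peaks p (splice b f) =
  peaks true (splice true f) + [&& ~~ p, b & ~~ nonempty f].
Proof.
rewrite /peaks; case: f => [|y f] /=; first by rewrite addn0 orbF andbT.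
by rewrite orbT !andbF addn0.
Qed.

(* A factor UD survives if and only if neither of its letters is replaced; [a]
   tells whether a factor is inserted at the preceding letter [p]. *)
Lemma peaks_splices_from p a s fs : size fs = size s ->
  peaks (p || a) (splices s fs) =
  sumn [seq peaks true (splice true f) | f <- fs] +
    let m := fiber (kinds p s) (map nonempty fs) in
    count (fun x => ~~ x.1 && ~~ x.2)
      (zip (nseq (~~ p && head false s) a ++ m (false, true)) (m (true, true))).
Proof.
elim: s p a fs => [|b s IHs] p a [|f fs] //=; first by rewrite andbF.
move=> [/(IHs b (nonempty f)) peaks_s].
rewrite peaks_cat peaks_splice [last _ _]last_rcons peaks_s negb_or addnACA.
congr (_ + _); rewrite /fiber /=.
by case: b p {IHs peaks_s} => [] [] //=; rewrite ?andbF; case: (head false s).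
Qed.

Lemma peaks_splices s fs : size fs = size s ->
  peaks true (splices s fs) =
  sumn [seq peaks true (splice true f) | f <- fs] +
    count (fun x => ~~ x.1 && ~~ x.2)
      (zip (marks s fs (false, true)) (marks s fs (true, true))).
Proof. exact: (@peaks_splices_from true true). Qed.

Lemma last_splices_from p a s fs : size fs = size s ->
  last (p || a) (splices s fs) = last p s || last a (map nonempty fs).
Proof.
elim: s p a fs => [|b s IHs] p a [|f fs] //= [/(IHs b (nonempty f)) <-].
by rewrite last_cat last_rcons.
Qed.

Lemma last_splices s fs : size fs = size s -> 0 < size s ->
  last false (splices s fs) =
  last false s || last false (marks s fs (false, false)).
Proof.
move=> sz_fs s_gt0; rewrite (@last_splices_from false false) //.
case last_s: (last false s) => //=; have kinds_neq0 : kinds true s != [::].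
  by rewrite -size_eq0 size_kinds -lt0n.
rewrite -(last_fiber _ (false, false) kinds_neq0) ?size_map ?size_kinds //.
by rewrite last_kinds //; case: (s) s_gt0 last_s.
Qed.

Lemma nth1_splices s fs : size fs = size s -> head true s = false ->
  nth false (splices s fs) 1 =
  if head false (marks s fs (false, nth false s 1))
  then nth false (splice false (head [::] (filter nonempty fs))) 1
  else nth false s 1 && ~~ head false (marks s fs (true, true)).
Proof.
case: s fs => [|[] s] [|f fs] // [sz_fs] _.
rewrite /marks /fiber /= -nth0 eqxx /=.
case: f => [|y f] /=; last by rewrite nth_cat /= size_rcons.
by case: s fs sz_fs => [|[] s] [|f' fs] //= _; case: f'.
Qed.

(** * Moving factors from one pattern to another *)

(* The factors are carried over in order, to the places obtained by
   redistributing their old places along the kinds of the letters. *)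
Definition reinsert (s s' : bitseq) (fs : seq (seq nat)) : seq (seq nat) :=
  let g := map nonempty fs in
  redistribute g (redistribute (kinds true s) (kinds true s') g) fs.

Lemma filter_nonempty fs : filter nonempty fs = fiber (map nonempty fs) fs true.
Proof.
by rewrite filter_mask /fiber -map_comp (eq_map (fun f => eqb_id _)).
Qed.

Lemma flatten_nonempty fs : flatten (filter nonempty fs) = flatten fs.
Proof. by elim: fs => [|[|y f] fs IHfs] //=; rewrite IHfs. Qed.

Section Reinsert.

Variables (s s' : bitseq) (fs : seq (seq nat)).
Hypotheses (eq_size : size s = size s') (eq_profile : profile s = profile s')
  (sz_fs : size fs = size s).

Let perm_kinds_ss' : perm_eq (kinds true s) (kinds true s').
Proof.
by case: eq_profile => *; apply: perm_kinds => //; apply: perm_bitseq.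
Qed.

Let size_occupied : size (map nonempty fs) = size (kinds true s).
Proof. by rewrite size_map size_kinds. Qed.

Let perm_occupied : perm_eq (map nonempty fs)
  (redistribute (kinds true s) (kinds true s') (map nonempty fs)).
Proof. by rewrite perm_sym perm_redistribute. Qed.

Let size_fs : size fs = size (map nonempty fs).
Proof. by rewrite size_map. Qed.

Lemma map_reinsert : map nonempty (reinsert s s' fs) =
  redistribute (kinds true s) (kinds true s') (map nonempty fs).
Proof. by rewrite map_redistribute (redistribute_keys perm_occupied). Qed.

Lemma size_reinsert : size (reinsert s s' fs) = size s'.
Proof. by rewrite !size_redistribute // size_kinds. Qed.

Lemma perm_reinsert : perm_eq (reinsert s s' fs) fs.
Proof. exact: perm_redistribute perm_occupied size_fs. Qed.

Lemma filter_reinsert : filter nonempty (reinsert s s' fs) = filter nonempty fs.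
Proof. by rewrite !filter_nonempty map_reinsert fiber_redistribute. Qed.

Lemma flatten_reinsert : flatten (reinsert s s' fs) = flatten fs.
Proof. by rewrite -flatten_nonempty filter_reinsert flatten_nonempty. Qed.

Lemma marks_reinsert : marks s' (reinsert s s' fs) =1 marks s fs.
Proof. by move=> k; rewrite /marks map_reinsert fiber_redistribute. Qed.

Lemma reinsertK : reinsert s' s (reinsert s s' fs) = fs.
Proof. by rewrite {1}/reinsert map_reinsert !redistributeK. Qed.

Lemma profile_reinsert e :
    0 < size s -> head true s = false -> head true s' = false ->
  profile (splices s' (reinsert s s' fs) ++ pattern (0 :: e)) =
  profile (splices s fs ++ pattern (0 :: e)).
Proof.
move=> s_gt0 s_U s'_U; have [_ _ eq_snd eq_last] := eq_profile.
have sz_fs' := size_reinsert.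
have sum_eq F : sumn (map F (reinsert s s' fs)) = sumn (map F fs).
  exact/perm_sumn/perm_map/perm_reinsert.
have peaks_U p : peaks p (pattern (0 :: e)) = peaks true (pattern (0 :: e)).
  by case: (e) => [|y e']; rewrite /peaks //= andbF.
congr (_, _, _, _).
- rewrite !peaks_cat peaks_U [in RHS]peaks_U !peaks_splices // sum_eq.
  by rewrite !marks_reinsert.
- rewrite !count_cat !(count_splices true) // sum_eq map_reinsert.
  by rewrite (permP (perm_zip_redistribute perm_kinds_ss' size_occupied)).
- rewrite !nth_cat !size_splices // -eq_size flatten_reinsert.
  case: ifP => // _.
  by rewrite !nth1_splices // !marks_reinsert filter_reinsert eq_snd.
- have s'_gt0 : 0 < size s' by rewrite -eq_size.
  by rewrite !last_cat !last_splices // marks_reinsert eq_last.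
Qed.

End Reinsert.

(** * Shuffles as insertions *)

(* [fs] lists the factors put before each letter of [p], and [e] comes last. *)
Fixpoint weave (p : seq nat) (fs : seq (seq nat)) (e : seq nat) : seq nat :=
  if (p, fs) is (x :: p', f :: fs') then f ++ x :: weave p' fs' e else e.

Fixpoint gaps (p t : seq nat) : seq (seq nat) * seq nat :=
  if p is x :: p' then
    let r := gaps p' (drop (index x t).+1 t) in (take (index x t) t :: r.1, r.2)
  else ([::], t).

Lemma size_gaps p t : size (gaps p t).1 = size p.
Proof. by elim: p t => [|x p IHp] t //=; rewrite IHp. Qed.

Lemma gapsK p t : subseq p t -> weave p (gaps p t).1 (gaps p t).2 = t.
Proof.
elim: p t => [|x p IHp] t //= sub.
have x_t : x \in t by apply: (mem_subseq sub); rewrite inE eqxx.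
rewrite IHp; last first.
  elim: t sub x_t {IHp} => [|y t IHt] //=; rewrite inE [y == x]eq_sym.
  by case: (x == y) => /=; [rewrite drop0 | apply: IHt].
have := cat_take_drop (index x t) t.
by rewrite [drop (index x t) t](drop_nth 0) ?index_mem // nth_index.
Qed.

Lemma weaveK p fs e : size fs = size p -> ~~ has [in flatten fs] p ->
  gaps p (weave p fs e) = (fs, e).
Proof.
elim: p fs => [|x p IHp] [|f fs] //= [sz_fs].
rewrite mem_cat !negb_or -andbA => /and3P[x_f _ disj].
rewrite index_cat (negPf x_f) /= eqxx addn0 take_size_cat //.
rewrite -cat_rcons drop_size_cat ?size_rcons // IHp //.
by apply: contra disj; apply: sub_has => y /=; rewrite mem_cat orbC => ->.
Qed.

Lemma perm_weave p fs e : size fs = size p ->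
  perm_eq (weave p fs e) (p ++ (flatten fs ++ e)).
Proof.
elim: p fs => [|x p IHp] [|f fs] //= [sz_fs].
rewrite -cat1s perm_catCA /= perm_cons -catA perm_sym perm_catCA perm_cat2l.
by rewrite perm_sym IHp.
Qed.

Lemma subseq_weavel p fs e : size fs = size p -> subseq p (weave p fs e).
Proof.
elim: p fs => [|x p IHp] [|f fs] //= => [_|[sz_fs]]; first exact: sub0seq.
by rewrite -[x :: p]cat0s cat_subseq ?sub0seq //= eqxx IHp.
Qed.

Lemma subseq_weaver p fs e : size fs = size p ->
  subseq (flatten fs ++ e) (weave p fs e).
Proof.
elim: p fs => [|x p IHp] [|f fs] //= [sz_fs].
rewrite -catA cat_subseq //; apply: subseq_trans (subseq_cons _ _).
exact: IHp.
Qed.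

Lemma filter_weave (a : pred nat) p fs e : size fs = size p -> ~~ has a p ->
  all a (flatten fs ++ e) -> filter a (weave p fs e) = flatten fs ++ e.
Proof.
elim: p fs => [|x p IHp] [|f fs] //= => [_ _ /all_filterP //|[sz_fs]].
rewrite negb_or -!catA all_cat => /andP[/negPf not_ax not_ap] /andP[af afs].
by rewrite filter_cat /= not_ax IHp // (all_filterP af).
Qed.

Lemma gaps_shuffle p sigma t : uniq (p ++ sigma) -> t \in shuffles p sigma ->
  weave p (gaps p t).1 (gaps p t).2 = t /\
  flatten (gaps p t).1 ++ (gaps p t).2 = sigma.
Proof.
move=> uniq_ps; rewrite mem_filter mem_permutations.
move=> /andP[/andP[sub_p sub_sigma] perm_t].
have def_t := gapsK sub_p; have sz := size_gaps p t; split=> //.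
have uniq_t : uniq t by rewrite (perm_uniq perm_t).
have perm_fs : perm_eq (flatten (gaps p t).1 ++ (gaps p t).2) sigma.
  by rewrite -(perm_cat2l p) -(permPl (perm_weave _ sz)) def_t.
rewrite [RHS](subseq_uniqP uniq_t sub_sigma) -[in RHS]def_t filter_weave //.
  by have := uniq_ps; rewrite uniq_catC cat_uniq => /and3P[].
by apply/allP => x; rewrite (perm_mem perm_fs).
Qed.

Lemma weave_shuffle p sigma fs e : uniq (p ++ sigma) -> size fs = size p ->
    flatten fs ++ e = sigma ->
  weave p fs e \in shuffles p sigma /\ gaps p (weave p fs e) = (fs, e).
Proof.
move=> + sz_fs def_sigma; rewrite uniq_catC cat_uniq => /and3P[_ disj _].
split; last first.
  apply: weaveK => //; apply: contra disj; apply: sub_has => x /= x_fs.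
  by rewrite -def_sigma mem_cat x_fs.
rewrite mem_filter mem_permutations subseq_weavel // -def_sigma.
by rewrite subseq_weaver // perm_weave.
Qed.

Lemma pattern_weave x p fs e : size fs = size p ->
    allrel ltn (x :: p) (flatten fs ++ e) ->
  pattern (x :: weave p fs e) =
  splices (pattern (x :: p)) fs ++ pattern (0 :: e).
Proof.
elim: p x fs => [|y p IHp] x [|f fs] //=.
  case: e => [|z e] //= _; rewrite allrel_consr => /andP[/andP[lt_xz _] _].
  by congr (_ :: _); apply/negbTE; rewrite -leqNgt ltnW.
move=> [sz_fs]; rewrite -catA allrel_catr => /andP[lt_f lt_fs].
have lt_yp : allrel ltn (y :: p) (flatten fs ++ e).
  by move: lt_fs; rewrite allrel_consl => /andP[].
have /= := IHp y fs sz_fs lt_yp; rewrite pairmap_cat -catA /= => ->.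
rewrite /splice; case: f lt_f => [|z f] /=; first by rewrite orbF.
rewrite !allrel_consl => /and3P[/andP[lt_xz _] lt_y _].
have -> : (z < x) = false by lia.
have -> : y < last z f by exact: (allP lt_y _ (mem_last z f)).
by rewrite cat_rcons [nonempty _]/= orbT.
Qed.

(** * Shuffle compatibility *)

Lemma perm_map_bij (A B C : eqType) (s : seq A) (t : seq B)
    (f : A -> C) (g : B -> C) (phi : A -> B) (psi : B -> A) :
    uniq s -> uniq t ->
    {in s, forall x, [/\ phi x \in t, psi (phi x) = x & g (phi x) = f x]} ->
    {in t, forall y, psi y \in s /\ phi (psi y) = y} ->
  perm_eq (map f s) (map g t).
Proof.
move=> uniq_s uniq_t phiP psiP.
have -> : map f s = map g (map phi s).
  by rewrite -map_comp; apply/eq_in_map => x /phiP[].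
apply/perm_map/uniq_perm => //.
  rewrite map_inj_in_uniq // => x y /phiP[_ phixK _] /phiP[_ phiyK _] eq_phi.
  by rewrite -phixK eq_phi.
move=> y; apply/mapP/idP => [[x /phiP[phi_x _ _] ->] //|/psiP[psi_y psiK]].
by exists (psi y).
Qed.

Definition dominated (p sigma : seq nat) : bool :=
  uniq (0 :: p ++ sigma) && allrel ltn (0 :: p) sigma.

Lemma dominated_no_flat p sigma : dominated p sigma -> no_flat (0 :: p).
Proof.
by rewrite /dominated -cat_cons cat_uniq => /andP[/andP[/uniq_no_flat]].
Qed.

Lemma no_flat_shuffle p sigma t :
  dominated p sigma -> t \in shuffles p sigma -> no_flat (0 :: t).
Proof.
move=> /andP[uniq_ps _]; rewrite mem_filter mem_permutations => /andP[_ perm_t].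
by apply: uniq_no_flat; rewrite /= (perm_mem perm_t) (perm_uniq perm_t).
Qed.

Lemma size_shuffle p sigma t :
  t \in shuffles p sigma -> size t = size p + size sigma.
Proof.
rewrite mem_filter mem_permutations => /andP[_ /perm_size ->].
exact: size_cat.
Qed.

Lemma head_pattern0 w : 0 < size w -> head true (pattern (0 :: w)) = false.
Proof. by case: w. Qed.

Definition reshuffle (p q t : seq nat) : seq nat :=
  let r := gaps p t in
  weave q (reinsert (pattern (0 :: p)) (pattern (0 :: q)) r.1) r.2.

Lemma reshuffleP p q sigma t :
    dominated p sigma -> dominated q sigma -> size p = size q -> 0 < size p ->
    stat p = stat q -> t \in shuffles p sigma ->
  [/\ reshuffle p q t \in shuffles q sigma, reshuffle q p (reshuffle p q t) = t
    & stat (reshuffle p q t) = stat t].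
Proof.
move=> dom_p dom_q eq_size p_gt0 eq_stat t_shuffle.
have q_gt0 : 0 < size q by rewrite -eq_size.
have /andP[/andP[_ uniq_p] lt_p] := dom_p.
have /andP[/andP[_ uniq_q] lt_q] := dom_q.
have eq_profile : profile (pattern (0 :: p)) = profile (pattern (0 :: q)).
  apply/eqP; rewrite -stat_eq_profile ?eq_stat //.
    exact: dominated_no_flat dom_p.
  exact: dominated_no_flat dom_q.
have [def_t def_sigma] := gaps_shuffle uniq_p t_shuffle.
rewrite /reshuffle; set fs := (gaps p t).1 in def_t def_sigma *.
set e := (gaps p t).2 in def_t def_sigma *.
set s := pattern (0 :: p) in eq_profile *.
set s' := pattern (0 :: q) in eq_profile *.
have sz_fs : size fs = size p := size_gaps p t.
have eq_size_s : size s = size s' by rewrite !size_pattern.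
have sz_fs_s : size fs = size s by rewrite size_pattern.
have sz_fs' : size (reinsert s s' fs) = size q.
  by rewrite size_reinsert // size_pattern.
have def_sigma' : flatten (reinsert s s' fs) ++ e = sigma.
  by rewrite flatten_reinsert.
have [t'_shuffle ->] := weave_shuffle uniq_q sz_fs' def_sigma'.
split=> //; first by rewrite reinsertK // def_t.
apply/eqP; rewrite stat_eq_profile.
- rewrite -[in t in _ == profile t]def_t.
  rewrite !pattern_weave ?def_sigma ?def_sigma' //.
  by rewrite profile_reinsert ?size_pattern ?head_pattern0.
- exact: no_flat_shuffle t'_shuffle.
- exact: no_flat_shuffle t_shuffle.
- by rewrite (size_shuffle t'_shuffle) addn_gt0 q_gt0.
- by rewrite (size_shuffle t_shuffle) addn_gt0 p_gt0.
Qed.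

Lemma stat_shuffle_compatible p q sigma :
    dominated p sigma -> dominated q sigma -> size p = size q -> 0 < size p ->
    stat p = stat q ->
  perm_eq (statS p sigma) (statS q sigma).
Proof.
move=> dom_p dom_q eq_size p_gt0 eq_stat.
apply: (@perm_map_bij _ _ _ _ _ stat stat (reshuffle p q) (reshuffle q p)).
- by rewrite filter_uniq ?permutations_uniq.
- by rewrite filter_uniq ?permutations_uniq.
- by move=> t; apply: reshuffleP.
- move=> t; rewrite eq_size in p_gt0.
  by case/(reshuffleP dom_q dom_p (esym eq_size) p_gt0 (esym eq_stat)).
Qed.

(** * Hook-shaped patterns *)

Lemma pattern_map (f : nat -> nat) w :
  {mono f : x y / x < y} -> pattern (map f w) = pattern w.
Proof.
move=> f_mono; case: w => [|x w] //=.
by elim: w x => [|y w IHw] x //=; rewrite IHw f_mono.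
Qed.

Lemma pattern_realizable (s : bitseq) :
  exists2 w, w \in L (iota 1 (size s).+1) & pattern w = s.
Proof.
elim: s => [|b s [w w_L pattern_w]]; first by exists [:: 1].
have w_le x : x \in w -> 0 < x < (size s).+2.
  by rewrite (perm_mem w_L) mem_iota add1n.
case: b.
  exists ((size s).+2 :: w).
    rewrite -cat1s unfold_in perm_catC perm_sym.
    by rewrite -[size (true :: s)]addn1 -addSn iotaD add1n perm_cat2r perm_sym.
  case: w w_L pattern_w w_le => [/perm_size //|x w] _ <- w_le /=.
  by congr (_ :: _); have /andP[_ ->] := w_le x (mem_head x w).
exists (1 :: map S w).
  rewrite unfold_in -[iota 1 _]/(1 :: iota (1 + 1) (size s).+1) perm_cons.
  by rewrite iotaDl (eq_map add1n) perm_map.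
rewrite -pattern_w -(pattern_map w (f := S)) //.
case: w w_L {pattern_w} w_le => [/perm_size //|x w] _ w_le /=.
by have /andP[x_gt0 _] := w_le x (mem_head x w); congr (_ :: _); lia.
Qed.

Fixpoint expand (b : bool) (rs : seq nat) : bitseq :=
  if rs is r :: rs' then nseq r b ++ expand (~~ b) rs' else [::].

Lemma head_expand b rs : all (leq 1) rs -> head b (expand b rs) = b.
Proof. by case: rs => [|[|r] rs]. Qed.

Lemma expandK b rs : all (leq 1) rs -> runs (expand b rs) = rs.
Proof.
elim: rs b => [|[|r] rs IHrs] b //= rs_gt0.
elim: r => [|r IHr] /=; last by rewrite eqxx IHr.
by rewrite head_expand //; case: eqP => [|_]; [case: (b) | rewrite IHrs].
Qed.

Lemma runsK b s : expand b (runs (b :: s)) = b :: s.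
Proof.
elim: s b => [|c s IHs] b; first by case: b.
rewrite runs_cons; case: eqP => [->|neq_bc].
  have := head_runs_gt0 c s; rewrite -[RHS]/(c :: (c :: s)) -[in RHS]IHs.
  by case: (runs (c :: s)).
by have -> : c = ~~ b; [case: b c neq_bc {IHs} => [] [] | rewrite /= IHs].
Qed.

Fixpoint alternate_sums (rs : seq nat) : nat * nat :=
  if rs is r :: rs' then
    let: (x, y) := alternate_sums rs' in (r + y, x)
  else (0, 0).

Lemma count_expand b rs :
  alternate_sums rs =
  (count_mem b (expand b rs), count_mem (~~ b) (expand b rs)).
Proof.
elim: rs b => [|r rs IHrs] b //=.
rewrite (IHrs (~~ b)) negbK !count_cat !count_nseq.
by case: b; rewrite /= mul1n mul0n.
Qed.

Lemma alternate_sums_ge rs : all (leq 1) rs ->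
  uphalf (size rs) <= (alternate_sums rs).1 /\
  (size rs)./2 <= (alternate_sums rs).2.
Proof.
elim: rs => [|r rs IHrs] //= /andP[r_gt0 /IHrs[]].
by case: (alternate_sums rs) => x y /=; lia.
Qed.

Lemma alternate_sums_nseq1 j : alternate_sums (nseq j 1) = (uphalf j, j./2).
Proof. by elim: j => //= j ->. Qed.

Lemma hook_typeSS r t1 t2 : hook_type r.+2 t1 t2 = [:: t1, t2 & nseq r 2].
Proof.
have twos k : map (nth 2 [:: t1; t2]) (iota k.+2 r) = nseq r 2.
  by elim: r k => [|r IHr] k //=; rewrite IHr nth_nil.
by rewrite /hook_type /mkseq /= twos.
Qed.

(* The excess of the entries over 1 is moved to the first two entries. *)
Lemma hook_composition rs : all (leq 1) rs ->
  exists hs, [/\ all (leq 1) hs, alternate_sums hs = alternate_sums rs &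
    map S hs = hook_type (size rs) ((alternate_sums rs).1.+2 - uphalf (size rs))
                                   ((alternate_sums rs).2.+2 - (size rs)./2)].
Proof.
case: rs => [|r1 [|r2 rs]] rs_gt0; first by exists [::].
  by exists [:: r1]; split=> //; rewrite /hook_type /mkseq /= addn0 subn1.
have [] := alternate_sums_ge rs_gt0; set r := size rs.
rewrite [size _]/= -/r; case: (alternate_sums _) => x y /= le_x le_y.
exists [:: x.+1 - (uphalf r).+1, y.+1 - r./2.+1 & nseq r 1]; split.
- by rewrite /= all_nseq orbT andbT; lia.
- by rewrite /= alternate_sums_nseq1; congr (_, _); lia.
- by rewrite hook_typeSS /= map_nseq; congr [:: _, _ & _]; lia.
Qed.

Lemma hook_pattern b s : let r := size (runs (b :: s)) in
  exists t, [/\ head false t = b, perm_eq t (b :: s) &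
    map S (runs t) = hook_type r ((count_mem b (b :: s)).+2 - uphalf r)
                                 ((count_mem (~~ b) (b :: s)).+2 - r./2)].
Proof.
move=> r; have := count_expand b (runs (b :: s)); rewrite runsK.
have [hs [hs_gt0 sums_hs map_hs]] := hook_composition (runs_gt0 (b :: s)).
move=> sums_s; exists (expand b hs); split.
- case: hs hs_gt0 {sums_hs} map_hs => [_ /(congr1 size)|[|h] hs] //.
  by rewrite size_mkseq; case: (runs _) (head_runs_gt0 b s).
- have := count_expand b hs; rewrite sums_hs sums_s => -[eq_b eq_Nb].
  apply/allP => c _; have : (c == b) || (c == ~~ b) by case: (c); case: (b).
  by case/orP=> /eqP->; apply/eqP.
- by rewrite expandK // map_hs sums_s.
Qed.

Lemma dominated_L n m p sigma :
  p \in L (iota 1 n) -> sigma \in L (iota n.+1 m) -> dominated p sigma.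
Proof.
rewrite !unfold_in => p_L sigma_L; have := perm_cat p_L sigma_L.
rewrite -add1n -iotaD /dominated /= => ps_L.
rewrite (perm_mem ps_L) (perm_uniq ps_L) mem_iota iota_uniq.
apply/allrelP => x y; rewrite inE (perm_mem p_L) (perm_mem sigma_L) !mem_iota.
by rewrite /=; lia.
Qed.

Lemma size_L n w : w \in L (iota 1 n) -> size w = n.
Proof. by move/perm_size; rewrite size_iota. Qed.

Lemma no_flat_L n w : w \in L (iota 1 n) -> no_flat (0 :: w).
Proof.
by move/(@dominated_L n 0 w [::])/(_ (perm_refl _))/dominated_no_flat.
Qed.

Lemma hook_permutation n pi : 0 < n -> pi \in L (iota 1 n) ->
  let r := size (type pi) in let d := des pi in
  exists pi', [/\ pi' \in L (iota 1 n), chi_plus pi' = chi_plus pi,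
    stat pi' = stat pi &
    type pi' =
      if chi_plus pi == 1 then hook_type r (d.+2 - uphalf r) (n.+1 - d - r./2)
      else hook_type r (n.+1 - d - uphalf r) (d.+2 - r./2)].
Proof.
move=> n_gt0 pi_L r d; have [n_gt1|n_le1] := ltnP 1 n; last first.
  have n1 : n = 1 by lia.
  have def_pi : pi = [:: 1] by move: pi_L; rewrite n1 => /perm_small_eq ->.
  by exists pi; split=> //; rewrite /r /d def_pi n1.
have type_L w (w_L : w \in L (iota 1 n)) : type w = map S (runs (pattern w)).
  by rewrite type_pattern ?(size_L w_L) //; apply: path_sorted (no_flat_L w_L).
have size_pattern_pi : size (pattern pi) = n.-1.
  by rewrite size_pattern (size_L pi_L).
case pattern_pi : (pattern pi) size_pattern_pi => [|b s] size_pattern_pi.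
  by rewrite /= in size_pattern_pi; lia.
have [t [head_t perm_t runs_t]] := hook_pattern b s.
have [pi' pi'_L pattern_pi'] := pattern_realizable t.
rewrite (perm_size perm_t) size_pattern_pi prednK // in pi'_L.
have chi_pi' : chi_plus pi' = chi_plus pi.
  by rewrite !chi_plus_pattern pattern_pi pattern_pi' head_t.
have des_pi' : des pi' = des pi.
  by rewrite !des_pattern pattern_pi pattern_pi' (permP perm_t).
have size_type' : size (type pi') = r.
  by rewrite /r !type_L // pattern_pi pattern_pi' runs_t size_mkseq size_map.
exists pi'; split=> //.
  rewrite (stat_type (no_flat_L pi_L)) ?(size_L pi_L) //.
  rewrite (stat_type (no_flat_L pi'_L)) ?(size_L pi'_L) //.
  by rewrite chi_pi' des_pi' size_type'.
have count_U : (count_mem false (b :: s)).+2 = n.+1 - count_mem true (b :: s).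
  rewrite count_mem_false count_mem_true size_pattern_pi.
  by have := count_size id (b :: s); rewrite size_pattern_pi; lia.
rewrite type_L // pattern_pi' runs_t /r /d type_L // pattern_pi size_map.
rewrite chi_plus_pattern des_pattern pattern_pi -count_mem_true -count_U.
by case: b {pattern_pi size_pattern_pi head_t perm_t runs_t count_U}.
Qed.

Theorem theorem1 (m n k d : nat) (pi sigma : seq nat)
  (hm : 1 <= m) (hn : 1 <= n)
  (hpi : pi \in L (iota 1 n)) (hpk : pk pi = k) (hdes : des pi = d)
  (hsigma : sigma \in L (iota n.+1 m)) :
  [/\ (size (type pi) = 2 * k -> chi_plus pi = 0 -> pi \notin Pi1 n k d ->
        exists pi' : seq nat, [/\ pi' \in Pi1 n k d, stat pi = stat pi' &
          perm_eq (statS pi sigma) (statS pi' sigma)]),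
      (size (type pi) = 2 * k + 1 -> chi_plus pi = 0 -> pi \notin Pi2 n k d ->
        exists pi' : seq nat, [/\ pi' \in Pi2 n k d, stat pi = stat pi' &
          perm_eq (statS pi sigma) (statS pi' sigma)]),
      (size (type pi) = 2 * k + 1 -> chi_plus pi = 1 -> pi \notin Pi3 n k d ->
        exists pi' : seq nat, [/\ pi' \in Pi3 n k d, stat pi = stat pi' &
          perm_eq (statS pi sigma) (statS pi' sigma)]) &
      (size (type pi) = 2 * k + 2 -> chi_plus pi = 1 -> pi \notin Pi4 n k d ->
        exists pi' : seq nat, [/\ pi' \in Pi4 n k d, stat pi = stat pi' &
          perm_eq (statS pi sigma) (statS pi' sigma)])].
Proof.
have [pi' [hpi' chi' stat' type']] := hook_permutation hn hpi.
have statS' : perm_eq (statS pi sigma) (statS pi' sigma).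
  apply: stat_shuffle_compatible; rewrite ?(size_L hpi) ?(size_L hpi') //.
  - exact: dominated_L hpi hsigma.
  - exact: dominated_L hpi' hsigma.
rewrite hdes in type'.
split=> size_type chi _; exists pi'; split=> //; apply/and3P; split=> //;
  rewrite ?chi' ?chi // type' chi size_type;
  by apply/eqP; congr hook_type; lia.
Qed.
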